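(* Let $L$ be a Latin square of order $10$ whose rows $6,\dots,9$ and columns $6,\dots,9$ form a $4\times4$ Latin subsquare on the symbols $\{0,1,2,3\}$, coloured as described in the context, and let $P,Q$ be Latin squares of order $10$ such that $(P,Q)$, $(P,L)$ and $(Q,L)$ are coloured TRPs. Then $(P,Q)$ is equivalent to a coloured TRP $(P',Q')$ in normal form, and the lower-right $4\times4$ Latin subsquare of $L$ can be taken to be $\Omega_1$ or $\Omega_2$; that is, applying to $L$ the same column and symbol permutations used in the transformation of $(P,Q)$ into $(P',Q')$, together with a permutation of the rows of $L$, yields a Latin square $L'$ whose subsquare in rows and columns $6,\dots,9$ is $\Omega_1$ or $\Omega_2$ and such that $(P',L')$ and $(Q',L')$ are coloured TRPs.
   Context: Squares have rows, columns indexed $\{0,\dots,9\}$ and symbols $\{0,\dots,9\}$. Two Latin squares $A,B$ form a TRP (transversal representation pair) if for all $i,i',j,j'$: $A[i,j]=B[i',j]$ and $A[i,j']=B[i',j']$ imply $j=j'$. The square $L$ is coloured as follows: a cell is white if its symbol lies in $\{0,1,2,3\}$; a cell in rows $0,\dots,5$ and columns $0,\dots,5$ with symbol in $\{4,\dots,9\}$ is dark; all other cells are light. If $(P,L)$ is a TRP, each cell $(i,j)$ of $P$ with $P[i,j]=k$ receives the colour of the cell in column $j$ of $L$ containing symbol $k$; a coloured TRP is a TRP with these induced colourings (and $(P,Q)$ is a coloured TRP when $P$, $Q$ carry these colourings and $(P,Q)$ is a TRP). A row of $P$ is of transversal type $p_k$ if it has exactly $k$ white cells among columns $6,\dots,9$.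 Two coloured TRPs are equivalent if one is obtained from the other by a composition of: permutations of the rows of $P$; permutations of the rows of $Q$; permutations of columns $0,\dots,5$ among themselves and of columns $6,\dots,9$ among themselves, applied simultaneously to $P$ and $Q$; permutations of the symbols that map $\{0,1,2,3\}$ to itself and $\{4,\dots,9\}$ to itself, applied simultaneously to $P$ and $Q$. A coloured TRP $(P,Q)$ is in normal form if in each of $P$ and $Q$ the rows are sorted by transversal type (if row $i$ has type $p_k$ and row $i'\ge i$ has type $p_{k'}$ then $k\le k'$), rows of the same transversal type are in increasing lexicographic order, and the first row of $P$ is one of $[0,1,2,4,5,6,3,7,8,9]$, $[0,1,3,4,5,6,2,7,8,9]$, $[0,2,3,4,5,6,1,7,8,9]$ with cells in columns $0,1,2,6$ white and cells in columns $3,4,5,7,8,9$ light. $\Omega_1$ has rows $[0,1,2,3],[1,2,3,0],[2,3,0,1],[3,0,1,2]$ and $\Omega_2$ has rows $[0,1,2,3],[1,0,3,2],[2,3,0,1],[3,2,1,0]$. *)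

(* Defs.v *)
From HB Require Import structures.
From mathcomp Require Import all_boot all_order all_fingroup all_algebra.
Set Implicit Arguments.
Unset Strict Implicit.
Unset Printing Implicit Defensive.

Inductive colour := White | Light | Dark.

Definition is_white (x : colour) : bool := if x is White then true else false.

Definition square := 'M['I_10]_10.

(* A cell of a coloured square is a pair (symbol, colour), so that permuting
   the cells carries the colours along. *)
Definition csquare := 'M['I_10 * colour]_10.

Definition symbols (A : csquare) : square := map_mx fst A.

Definition white_symbols : {set 'I_10} := [set k : 'I_10 | k < 4].

Definition latin_on (S : {set 'I_10}) (n : nat) (A : 'M['I_10]_n) : Prop :=
  [/\ forall i j, A i j \in S,
      forall i k, k \in S -> exists! j, A i j = k
    & forall j k, k \in S -> exists! i, A i j = k].

Definition latin (A : square) : Prop := latin_on [set: 'I_10] A.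

(* The block in rows 6,...,9 and columns 6,...,9. *)
Definition corner (L : square) : 'M['I_10]_4 := @drsubmx _ 6 4 6 4 L.

Definition trp (A B : square) : Prop :=
  [/\ latin A, latin B
    & forall i i' j j', A i j = B i' j -> A i j' = B i' j' -> j = j'].

Definition cell_colour (L : square) (i j : 'I_10) : colour :=
  if L i j \in white_symbols then White
  else if (i < 6) && (j < 6) then Dark else Light.

Definition colouring (L : square) : csquare :=
  (\matrix_(i < 10, j < 10) (L i j, cell_colour L i j))%R.

(* When L is Latin, the row i' is determined by the symbol of A i j: it is the
   row of the cell of column j of L containing that symbol, and the equality
   of pairs says that A i j has the colour of this cell. *)
Definition coloured_by (L : square) (A : csquare) : Prop :=
  forall i j, exists i', colouring L i' j = A i j.

(* The colours come from L; the pair (P, L) itself is the case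
   B = colouring L. *)
Definition coloured_trp (L : square) (A B : csquare) : Prop :=
  [/\ trp (symbols A) (symbols B), coloured_by L A & coloured_by L B].

(* The row i is of type p_k iff transversal_type A i = k. *)
Definition transversal_type (A : csquare) (i : 'I_10) : nat :=
  #|[set j : 'I_10 | (6 <= j) && is_white (A i j).2]|.

Definition row_word (A : csquare) (i : 'I_10) : seq nat :=
  [seq nat_of_ord (A i j).1 | j : 'I_10].

Definition sorted_rows (A : csquare) : Prop :=
  (forall i i' : 'I_10, i <= i' ->
     transversal_type A i <= transversal_type A i') /\
  (forall i i' : 'I_10, i < i' ->
     transversal_type A i = transversal_type A i' ->
     (row_word A i < row_word A i' :> seqlexi nat)%O).

Definition normal_first_row (A : csquare) : Prop :=
  row_word A ord0 \in [:: [:: 0; 1; 2; 4; 5; 6; 3; 7; 8; 9];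
                          [:: 0; 1; 3; 4; 5; 6; 2; 7; 8; 9];
                          [:: 0; 2; 3; 4; 5; 6; 1; 7; 8; 9]] /\
  forall j : 'I_10,
    (A ord0 j).2 = if nat_of_ord j \in [:: 0; 1; 2; 6] then White else Light.

Definition normal_form (L : square) (P Q : csquare) : Prop :=
  [/\ coloured_trp L P Q, sorted_rows P, sorted_rows Q & normal_first_row P].

Definition column_perm (c : 'S_10) : Prop :=
  forall j : 'I_10, (c j < 6) = (j < 6).

Definition symbol_perm (s : 'S_10) : Prop :=
  forall k : 'I_10, (s k \in white_symbols) = (k \in white_symbols).

Definition transform (r c s : 'S_10) (A : square) : square :=
  map_mx s (row_perm r (col_perm c A)).

Definition ctransform (r c s : 'S_10) (A : csquare) : csquare :=
  map_mx (fun x => (s x.1, x.2)) (row_perm r (col_perm c A)).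

(* Row, column and symbol permutations commute with each other, so every
   composition of the allowed operations consists of one permutation of each
   kind; c and s act simultaneously on both squares. *)
Definition equivalent_via (c s : 'S_10) (P Q P' Q' : csquare) : Prop :=
  [/\ column_perm c, symbol_perm s
    & exists rP rQ : 'S_10,
        P' = ctransform rP c s P /\ Q' = ctransform rQ c s Q].

Definition square4 (rows : seq (seq nat)) : 'M['I_10]_4 :=
  (\matrix_(i < 4, j < 4) inord (nth 0%N (nth [::] rows i) j))%R.

Definition Omega1 : 'M['I_10]_4 :=
  square4 [:: [:: 0; 1; 2; 3]; [:: 1; 2; 3; 0];
              [:: 2; 3; 0; 1]; [:: 3; 0; 1; 2]].

Definition Omega2 : 'M['I_10]_4 :=
  square4 [:: [:: 0; 1; 2; 3]; [:: 1; 0; 3; 2];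
              [:: 2; 3; 0; 1]; [:: 3; 2; 1; 0]].

(* Main.v *)
(* Each row of P is a transversal of L. If it meets the corner in k cells, then
   4 - k of its columns 0, ..., 5 carry a white cell and 4 - k others carry a
   cell from rows 6, ..., 9 of L, so 2 (4 - k) <= 6 and k >= 1; for k = 1 these
   columns are used up and the row has no dark cell. Since the corner cells of
   all rows number 16 < 2 * 10, some row has type p_1. Its only white cell in
   columns 6, ..., 9 has a column and a symbol which an isotopy of the corner
   onto Omega1 or Omega2 can send to column 6 and to a symbol other than 0; the
   remaining columns and symbols are then free enough to give the row one of
   the three required words. As this word starts with 0 and p_1 is the least
   possible type, sorting the rows of P puts this row first. *)

Require Import Defs.
From mathcomp Require Import all_boot all_order all_fingroup all_algebra.

Set Implicit Arguments.
Unset Strict Implicit.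
Unset Printing Implicit Defensive.

Import Order.TTheory.

(** * Permutations of finite sets: extending, stabilising, sorting *)

(** The images of [h] and [k] have complements of equal size; listing both and matching them index
    by index completes the partial map. This allows a permutation to be prescribed on some rows,
    columns or symbols only. *)
Lemma perm_extend (S T : finType) (h k : S -> T) :
  injective h -> injective k ->
  exists q : {perm T}, forall x, q (h x) = k x.
Proof.
move=> hI kI.
pose A := enum (~: (h @: setT)); pose B := enum (~: (k @: setT)).
have szAB : size A = size B.
  by rewrite -!cardE cardsCs [RHS]cardsCs !setCK !card_imset.
pose g y := if [pick x | h x == y] is Some x then k x
            else nth y B (index y A).
have gh x : g (h x) = k x.
  rewrite /g; case: pickP => [z /eqP/hI-> //|/(_ x)].
  by rewrite eqxx.
have gN y : (forall x, h x == y = false) ->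
    g y = nth y B (index y A) /\ y \in A.
  move=> Ny; split.
    by rewrite /g; case: pickP => [x|_]; first by rewrite Ny.
  rewrite mem_enum in_setC; apply/imsetP => -[x _ yx].
  by have := Ny x; rewrite yx eqxx.
have gB y : (forall x, h x == y = false) -> forall x, g y <> k x.
  move=> /gN[-> yA] x E; have := @mem_nth _ y B (index y A).
  rewrite -szAB index_mem E => /(_ yA).
  by rewrite mem_enum in_setC imset_f.
have gI : injective g.
  move=> y z; case: (pickP (fun x => h x == y)) => [x /eqP <-|Ny];
    case: (pickP (fun x => h x == z)) => [x' /eqP <-|Nz].
  - by rewrite !gh => /kI ->.
  - by rewrite gh => /esym /(gB _ Nz).
  - by rewrite gh => /(gB _ Ny).
  have [-> yA] := gN _ Ny; have [-> zA] := gN _ Nz.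
  rewrite (@set_nth_default _ B z y) -?szAB ?index_mem // => /eqP.
  rewrite nth_uniq ?enum_uniq -?szAB ?index_mem // => /eqP.
  exact: index_inj.
by exists (perm gI) => x; rewrite permE.
Qed.

Lemma perm_stable (T : finType) (A : {set T}) (q : {perm T}) :
  {in A, forall x, q x \in A} -> forall x, (q x \in A) = (x \in A).
Proof.
move=> qA; suff qE : q @: A = A.
  by move=> x; rewrite -{1}qE mem_imset //; apply: perm_inj.
apply/eqP; rewrite eqEcard card_imset ?leqnn ?andbT; last exact: perm_inj.
by apply/subsetP => y /imsetP[x xA ->]; apply: qA.
Qed.

(** Sending [i] to the number of smaller values of [f] is strictly monotone in [f i], hence a
    permutation; its inverse lists the values in increasing order. *)
Lemma rank_perm d (T : orderType d) n (f : 'I_n -> T) : injective f ->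
  exists p : 'S_n, forall i j : 'I_n, (i < j)%N -> (f (p i) < f (p j))%O.
Proof.
move=> fI; pose below i := [set k | (f k < f i)%O].
have rk i : (#|below i| < n)%N.
  rewrite -[X in (_ < X)%N]card_ord -cardsT proper_card //.
  by rewrite properT; apply/eqP => /setP/(_ i); rewrite !inE ltxx.
pose g i := Ordinal (rk i).
have gM i j : (f i < f j)%O -> (g i < g j)%N.
  move=> fij; apply: proper_card; apply/properP; split.
    by apply/subsetP=> k; rewrite !inE => /lt_trans; apply.
  by exists i; rewrite !inE ?ltxx.
have gI : injective g.
  move=> i j E; apply: fI; case: (ltgtP (f i) (f j)) => // /gM;
  by rewrite E ltnn.
exists (perm gI)^-1%g => i j.
rewrite -{1}(permKV (perm gI) i) -{1}(permKV (perm gI) j).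
move: ((perm gI)^-1%g i) ((perm gI)^-1%g j) => x y; rewrite !permE => lt.
case: (ltgtP (f x) (f y)) => // [/gM|/fI E].
  by rewrite ltnNge ltnW.
by rewrite E ltnn in lt.
Qed.

(** * Injectivity of rows and columns; sorting the rows *)

Lemma latin_on_row_inj S n (A : 'M_n) i : latin_on S A -> injective (A i).
Proof.
case=> AS Ar _ j j' E; have [k [_ U]] := Ar i _ (AS i j).
by rewrite -(U j) // -(U j').
Qed.

Lemma latin_on_col_inj S n (A : 'M_n) j : latin_on S A -> injective (A^~ j).
Proof.
case=> AS _ Ac i i' E; have [k [_ U]] := Ac j _ (AS i j).
by rewrite -(U i) // -(U i').
Qed.

Lemma row_word_nth (A : csquare) (i j : 'I_10) :
  nth 0 (row_word A i) j = (A i j).1.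
Proof.
by rewrite /row_word (nth_map ord0) ?size_enum_ord // nth_ord_enum.
Qed.

Lemma row_word_row_perm (r : 'S_10) (A : csquare) i :
  row_word (row_perm r A) i = row_word A (r i).
Proof. by apply: eq_map => j; rewrite mxE. Qed.

Lemma transversal_type_row_perm (r : 'S_10) (A : csquare) i :
  transversal_type (row_perm r A) i = transversal_type A (r i).
Proof. by apply: eq_card => j; rewrite !inE mxE. Qed.

(** Both sorting conditions together are one lexicographic order on pairs of type and word. The
    words are distinct because they already differ in column 0. *)
Lemma exists_sorted_rows (A : csquare) : latin (symbols A) ->
  exists r : 'S_10, sorted_rows (row_perm r A).
Proof.
move=> lA; pose f i : nat *l seqlexi nat :=
  (transversal_type A i, row_word A i : seqlexi nat).
have fI : injective f.
  move=> i i' [_ E]; apply: (latin_on_col_inj (j := ord0) lA).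
  by apply: val_inj; rewrite !mxE /= -!row_word_nth E.
have [r rP] := rank_perm fI; exists r.
split=> i i'; rewrite !transversal_type_row_perm.
  rewrite leq_eqVlt => /orP[/eqP/val_inj-> //|/rP].
  by rewrite ltEprodlexi => /andP[].
rewrite !row_word_row_perm => /rP.
rewrite ltEprodlexi /= => /andP[_ /implyP lt] E.
by apply: lt; rewrite E.
Qed.

(** * Latin squares of order 4 up to isotopy *)

Definition cyclic_rows : seq (seq nat) :=
  [:: [:: 0; 1; 2; 3]; [:: 1; 2; 3; 0]; [:: 2; 3; 0; 1]; [:: 3; 0; 1; 2]].

Definition klein_rows : seq (seq nat) :=
  [:: [:: 0; 1; 2; 3]; [:: 1; 0; 3; 2]; [:: 2; 3; 0; 1]; [:: 3; 2; 1; 0]].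

(* The last two tables are the cyclic group with involution 3 and 1. *)
Definition reduced_tables : seq (seq (seq nat)) :=
  [:: cyclic_rows; klein_rows;
   [:: [:: 0; 1; 2; 3]; [:: 1; 3; 0; 2]; [:: 2; 0; 3; 1]; [:: 3; 2; 1; 0]];
   [:: [:: 0; 1; 2; 3]; [:: 1; 0; 3; 2]; [:: 2; 3; 1; 0]; [:: 3; 2; 0; 1]]].

(** Each of the three unknown rows is one of 24 permutations, so all triples can be checked by
    computation; lists of naturals make this evaluable. *)
Lemma reduced_tables_complete (r1 r2 r3 : seq nat) :
  let perms := permutations (iota 0 4) in
  let rows := [:: iota 0 4; r1; r2; r3] in
  r1 \in perms -> r2 \in perms -> r3 \in perms ->
  map (head 0) rows = iota 0 4 ->
  (forall k, k < 4 -> uniq [seq nth 0 r k | r <- rows]) ->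
  rows \in reduced_tables.
Proof.
move=> perms rows p1 p2 p3 /eqP hd cols.
pose check r1 r2 r3 := let rows := [:: iota 0 4; r1; r2; r3] in
  (map (head 0) rows == iota 0 4) ==>
  all (fun k => uniq [seq nth 0 r k | r <- rows]) (iota 0 4) ==>
  (rows \in reduced_tables).
have /allP/(_ _ p1)/allP/(_ _ p2)/allP/(_ _ p3) :
  all (fun r1 => all (fun r2 => all (check r1 r2) perms) perms) perms.
  by vm_compute.
rewrite /check -/rows hd => /implyP/(_ isT)/implyP; apply.
by apply/allP => k; rewrite mem_iota => /cols.
Qed.

(** The reduced cyclic tables differ only in which element is the involution, and swapping it with 2
    gives [cyclic_rows]. The same [t] acts on rows, columns and symbols, and it fixes 0. *)
Lemma reduced_latin4 (g : 'I_4 -> 'I_4 -> 'I_4) :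
  (forall i, injective (g i)) -> (forall j, injective (g^~ j)) ->
  (forall j, g ord0 j = j) -> (forall i, g i ord0 = i) ->
  exists t : 'S_4, [/\ t ord0 = ord0, forall x, t (t x) = x &
    exists2 rows, rows \in [:: cyclic_rows; klein_rows] &
    forall i j, t (g (t i) (t j)) = nth 0 (nth [::] rows i) j :> nat].
Proof.
move=> gr gc g0 g1.
pose o k : 'I_4 := inord k.
have oK (i : 'I_4) : o i = i by rewrite /o inord_val.
have o0 : o 0 = ord0 by rewrite -[RHS]oK.
pose row i := [seq nat_of_ord (g i j) | j <- enum 'I_4].
have rowE i j : nth 0 (row i) j = g i (o j) :> nat \/ 4 <= j.
  case: (ltnP j 4) => [lj|]; [left|by right].
  rewrite (nth_map ord0) ?size_enum_ord //.
  by rewrite -[j]/(val (Ordinal lj)) nth_ord_enum oK.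
have row0 : row (o 0) = iota 0 4.
  by rewrite -val_enum_ord; apply: eq_map => j; rewrite o0 g0.
have row_perm i : row i \in permutations (iota 0 4).
  rewrite mem_permutations /row (map_comp val (g i)) -val_enum_ord perm_map //.
  apply: uniq_perm; rewrite ?(map_inj_uniq (gr i)) ?enum_uniq // => x.
  rewrite mem_enum inE; apply/mapP; exists (invF (gr i) x).
    by rewrite mem_enum.
  by rewrite f_invF.
pose rows := [seq row (o i) | i <- iota 0 4].
have gE i j : g i j = nth 0 (nth [::] rows i) j :> nat.
  rewrite (nth_map 0) ?size_iota // nth_iota // add0n oK.
  by case: (rowE i j); rewrite ?oK // leqNgt ltn_ord.
have : rows \in reduced_tables.
  rewrite /rows /= row0; apply: reduced_tables_complete => //.
    rewrite -row0; have hd i : head 0 (row i) = i.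
      by rewrite -nth0; case: (rowE i 0) => // ->; rewrite o0 g1.
    by rewrite /= !hd /o !inordK.
  move=> k lk; rewrite -row0.
  have -> : [:: row (o 0); row (o 1); row (o 2); row (o 3)] = rows by [].
  rewrite /rows -map_comp map_inj_in_uniq ?iota_uniq // => i i'.
  rewrite !mem_iota /= => li li'.
  case: (rowE (o i) k) => [->|]; last by rewrite leqNgt lk.
  case: (rowE (o i') k) => [->|]; last by rewrite leqNgt lk.
  by move=> /val_inj/gc/(congr1 val); rewrite /= !inordK.
(* The entries of [g] are replaced by those of a concrete table, so each case below is a check of 16
   entries. *)
have conjugate (t : 'S_4) rows' : t ord0 = ord0 -> (forall x, t (t x) = x) ->
    rows' \in [:: cyclic_rows; klein_rows] ->
    (forall i j, t (o (nth 0 (nth [::] rows (t i)) (t j))) =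
                 nth 0 (nth [::] rows' i) j :> nat) ->
    exists t : 'S_4, [/\ t ord0 = ord0, forall x, t (t x) = x &
    exists2 rows, rows \in [:: cyclic_rows; klein_rows] &
    forall i j, t (g (t i) (t j)) = nth 0 (nth [::] rows i) j :> nat].
  move=> t0 tt r' E; exists t; split=> //; exists rows' => // i j.
  by rewrite -E -gE oK.
have I4 (i : 'I_4) : i \in [:: o 0; o 1; o 2; o 3].
  rewrite -[i]oK; case: i => [] [|[|[|[|//]]]] l /=; by rewrite !inE eqxx ?orbT.
have oE : (o 0 = 0 :> nat) * (o 1 = 1 :> nat) *
          (o 2 = 2 :> nat) * (o 3 = 3 :> nat).
  by rewrite /o !inordK.
have neq a b : a < 4 -> b < 4 -> a != b -> o a != o b.
  by move=> la lb; rewrite -val_eqE /= !inordK.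
rewrite !inE => /or4P[] /eqP rowsE; rewrite {}rowsE in conjugate.
- apply: (conjugate 1%g cyclic_rows) => [|x||i j]; rewrite ?perm1 //.
  move: (I4 i) (I4 j); rewrite !inE.
  by case/or4P=> /eqP ->; case/or4P=> /eqP ->; rewrite !oE.
- apply: (conjugate 1%g klein_rows) => [|x||i j]; rewrite ?perm1 //.
  move: (I4 i) (I4 j); rewrite !inE.
  by case/or4P=> /eqP ->; case/or4P=> /eqP ->; rewrite !oE.
- apply: (conjugate (tperm (o 2) (o 3)) cyclic_rows) => [|x||i j] //.
  + by rewrite -o0 tpermD // neq.
  + by rewrite tpermK.
  + have tE := (tpermL (o 2) (o 3), tpermR (o 2) (o 3),
      @tpermD _ (o 2) (o 3) (o 0), @tpermD _ (o 2) (o 3) (o 1)).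
    move: (I4 i) (I4 j); rewrite !inE.
    by case/or4P=> /eqP ->; case/or4P=> /eqP ->;
       rewrite !tE ?neq // !oE /= ?tE ?neq // oE.
- apply: (conjugate (tperm (o 1) (o 2)) cyclic_rows) => [|x||i j] //.
  + by rewrite -o0 tpermD // neq.
  + by rewrite tpermK.
  + have tE := (tpermL (o 1) (o 2), tpermR (o 1) (o 2),
      @tpermD _ (o 1) (o 2) (o 0), @tpermD _ (o 1) (o 2) (o 3)).
    move: (I4 i) (I4 j); rewrite !inE.
    by case/or4P=> /eqP ->; case/or4P=> /eqP ->;
       rewrite !tE ?neq // !oE /= ?tE ?neq // oE.
Qed.

(** Sorting the rows by column [j0], then the columns by the first row, makes the square reduced and
    leaves [j0] in place 0. *)
Lemma latin4_isotopy (f : 'I_4 -> 'I_4 -> 'I_4) (j0 a : 'I_4) :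
  (forall i, injective (f i)) -> (forall j, injective (f^~ j)) ->
  exists r p s : 'S_4, [/\ p ord0 = j0, s a != ord0 &
    exists2 rows, rows \in [:: cyclic_rows; klein_rows] &
    forall i j, s (f (r i) (p j)) = nth 0 (nth [::] rows i) j :> nat].
Proof.
move=> fr fc.
(* Renaming [a] to 3 beforehand keeps it away from 0, since the later [t] fixes 0. *)
pose s0 : 'S_4 := tperm a ord_max.
have cI : injective (fun i => s0 (f i j0)) by move=> i i' /perm_inj/fc.
pose r0 := (perm cI)^-1%g.
have r0E i : s0 (f (r0 i) j0) = i by rewrite -[RHS](permKV (perm cI)) permE.
have rI : injective (fun j => s0 (f (r0 ord0) j)) by move=> j j' /perm_inj/fr.
pose p0 := (perm rI)^-1%g.
have p0E j : s0 (f (r0 ord0) (p0 j)) = j.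
  by rewrite -[RHS](permKV (perm rI)) permE.
have p00 : p0 ord0 = j0 by apply: (rI); rewrite p0E r0E.
pose g i j := s0 (f (r0 i) (p0 j)).
have [||||t [t0 tt [rows rowsP tg]]] := @reduced_latin4 g.
- by move=> i j j' /perm_inj/fr/perm_inj.
- by move=> j i i' /perm_inj/fc/perm_inj.
- exact: p0E.
- by move=> i; rewrite /g p00 r0E.
exists (t * r0)%g, (t * p0)%g, (s0 * t)%g; split.
- by rewrite permM t0.
- by rewrite permM tpermL -t0 (inj_eq perm_inj).
exists rows => // i j; by rewrite !permM tg.
Qed.

(** * White cells and transversal types *)

Lemma mem_white (k : 'I_10) : (k \in white_symbols) = (k < 4).
Proof. by rewrite inE. Qed.

Lemma card_white : #|white_symbols| = 4.
Proof. by rewrite -sum1dep_card big_mkcond !big_ord_recl big_ord0. Qed.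

Lemma card_high : #|[set j : 'I_10 | 6 <= j]| = 4.
Proof. by rewrite -sum1dep_card big_mkcond !big_ord_recl big_ord0. Qed.

Lemma high_rshift (j : 'I_10) : 6 <= j -> exists x : 'I_4, j = @rshift 6 4 x.
Proof.
move=> j6; have lt : j - 6 < 4 by rewrite ltn_subLR ?ltn_ord.
by exists (Ordinal lt); apply: val_inj; rewrite /= subnKC.
Qed.

Lemma white_lshift (k : 'I_10) : k \in white_symbols ->
  exists x : 'I_4, k = @lshift 4 6 x.
Proof.
by rewrite inE => lt; exists (Ordinal lt); apply: val_inj.
Qed.

Lemma colouring_white L i j :
  is_white (colouring L i j).2 = ((colouring L i j).1 \in white_symbols).
Proof.
by rewrite mxE /= /cell_colour; case: (_ \in _) => //; case: (_ && _).
Qed.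

Lemma coloured_by_white L (A : csquare) i j : coloured_by L A ->
  is_white (A i j).2 = ((A i j).1 \in white_symbols).
Proof. by move/(_ i j) => [i' <-]; apply: colouring_white. Qed.

(** Each row and column of the corner already contains all four white symbols, so none is left for
    the rest of that row or column of [L]. *)
Lemma corner_white (L : square) :
  latin L -> latin_on white_symbols (corner L) ->
  forall i j : 'I_10, (6 <= i) || (6 <= j) ->
  (L i j \in white_symbols) = (6 <= i) && (6 <= j).
Proof.
move=> lL [cS cr cc] i j.
have cE x y : corner L x y = L (@rshift 6 4 x) (@rshift 6 4 y).
  by rewrite !mxE.
case: (boolP (6 <= i)) => [/high_rshift[x ->]|i6] /=.
  case: (boolP (6 <= j)) => [/high_rshift[y ->]|j6] /= _.
    by rewrite -cE cS.
  apply/negP => /(cr x)[y [yE _]]; rewrite cE in yE.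
  by have jE := latin_on_row_inj lL yE; rewrite -jE in j6.
move=> /high_rshift[y jE]; apply/negP => w.
have [x [xE _]] := cc y _ w; rewrite cE -jE in xE.
by have iE := latin_on_col_inj (j := j) lL xE; rewrite -iE in i6.
Qed.

(** If [rho] repeated a row of [L], row [i] of [P] would agree with that row in two columns, against
    the TRP condition. *)
Lemma transversal (L : square) (P : csquare) i :
  coloured_trp L P (colouring L) ->
  exists rho : 'S_10, forall j, P i j = colouring L (rho j) j.
Proof.
case=> [[_ _ tr] cP _]; have [rho rhoE] := fin_all_exists (cP i).
have rI : injective rho.
  move=> j j' E; apply: (tr i (rho j)); rewrite [LHS]mxE [RHS]mxE.
    by rewrite rhoE.
  by rewrite E rhoE.
by exists (perm rI) => j; rewrite permE rhoE.
Qed.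

Lemma transversal_type_light (L : square) (P : csquare) i :
  latin L -> latin_on white_symbols (corner L) ->
  coloured_trp L P (colouring L) ->
  0 < transversal_type P i /\
  (transversal_type P i = 1 -> forall j,
   (P i j).2 = if (P i j).1 \in white_symbols then White else Light).
Proof.
move=> lL lC cP; have cw := corner_white lL lC.
have [[lP _ _] cbP _] := cP.
have [rho rhoE] := transversal i cP.
(* [B] holds the last four columns, [W] those where row [i] is white, [R] those whose cell comes
   from the last four rows of [L]. *)
pose B : {set 'I_10} := [set j : 'I_10 | 6 <= j].
pose W : {set 'I_10} := [set j | (P i j).1 \in white_symbols].
pose R : {set 'I_10} := [set j : 'I_10 | 6 <= rho j].
have WE j : (j \in W) = (L (rho j) j \in white_symbols) by rewrite inE rhoE mxE.
have RE j : (j \in R) = (6 <= rho j) by rewrite inE.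
have BE j : (j \in B) = (6 <= j) by rewrite inE.
have tE : transversal_type P i = #|W :&: B|.
  by apply: eq_card => j; rewrite !inE (coloured_by_white _ _ cbP) inE andbC.
have cW : #|W| = 4.
  have piI : injective (fun j => (P i j).1).
    by move=> j j' E; apply: (latin_on_row_inj (i := i) lP); rewrite !mxE.
  rewrite -[RHS]card_white -[RHS](card_preimset _ piI).
  by apply: eq_card => j; rewrite !inE.
have cR : #|R| = 4.
  rewrite -[RHS]card_high -[RHS](card_preimset _ (@perm_inj _ rho)).
  by apply: eq_card => j; rewrite !inE.
have eB : W :&: B = R :&: B.
  apply/setP => j; rewrite !in_setI WE RE BE.
  by case: (boolP (6 <= j)) => j6; rewrite ?andbF // !andbT cw j6 ?orbT ?andbT.
(* A white cell in the last four rows of [L] lies in the corner, hence in a column of [B]. *)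
have dWR : (W :\: B) :&: (R :\: B) = set0.
  apply/setP => j; rewrite in_set0 in_setI !in_setD WE RE BE.
  case: (boolP (6 <= rho j)); rewrite ?andbF //= => r6.
  case: (boolP (6 <= j)) => //= j6.
  by rewrite cw r6 // (negbTE j6).
have sub : (W :\: B) :|: (R :\: B) \subset ~: B.
  by apply/subsetP => j; rewrite !inE; case: (6 <= j).
have cB : #|~: B| = 6 by rewrite cardsCs setCK card_high card_ord.
have cU : #|(W :\: B) :|: (R :\: B)| = (4 - #|W :&: B|) + (4 - #|W :&: B|).
  by rewrite cardsU dWR cards0 subn0 !cardsD cW cR -eB.
split.
  (* Type 0 would require 4 + 4 columns among the first six. *)
  have := subset_leq_card sub; rewrite cU cB tE; by case: #|_|.
rewrite tE => t1; rewrite t1 in cU => j.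
(* For type 1 the 3 + 3 columns fill the first six: each cell there is white or from the last four
   rows, so never dark. *)
have : (j \in (W :\: B) :|: (R :\: B)) = (j < 6).
  have /eqP -> : (W :\: B) :|: (R :\: B) == ~: B by rewrite eqEcard sub cU cB.
  by rewrite !inE -ltnNge.
rewrite rhoE mxE /= /cell_colour -WE; case: ifP => // jW.
rewrite in_setU !in_setD jW andbF RE BE /= -!ltnNge.
by case: (j < 6); rewrite ?andbF //= leqNgt => /negbTE ->.
Qed.

(** Counting by columns: each of the last four columns of [P] contains every white symbol once. *)
Lemma sum_transversal_type (L : square) (P : csquare) :
  latin (symbols P) -> coloured_by L P -> \sum_i transversal_type P i = 16.
Proof.
move=> lP cbP.
have tE i : transversal_type P i =
    \sum_(j < 10 | 6 <= j) ((P i j).1 \in white_symbols).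
  rewrite /transversal_type -sum1dep_card -big_mkcondr.
  by apply: eq_bigl => j; rewrite (coloured_by_white _ _ cbP).
rewrite (eq_bigr _ (fun i _ => tE i)) exchange_big /=.
rewrite (eq_bigr (fun=> 4)) => [|j _].
  rewrite sum_nat_const -[16]/(4 * 4); congr (_ * _).
  by rewrite -[RHS]card_high cardsE.
have cI : injective (fun i => (P i j).1).
  by move=> i i' E; apply: (latin_on_col_inj (j := j) lP); rewrite !mxE.
rewrite -[RHS]card_white -[RHS](card_preimset _ cI) -sum1_card [RHS]big_mkcond.
by apply: eq_bigr => i _; rewrite !inE; case: (_ < _).
Qed.

Lemma exists_transversal_type1 (L : square) (P : csquare) :
  latin L -> latin_on white_symbols (corner L) ->
  coloured_trp L P (colouring L) -> exists i, transversal_type P i = 1.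
Proof.
move=> lL lC cP; have [[lP _ _] cbP _] := cP.
case: (pickP (fun i => transversal_type P i == 1)) => [i /eqP|none].
  by exists i.
have : \sum_(i < 10) 2 <= \sum_i transversal_type P i.
  apply: leq_sum => i _; have [t0 _] := transversal_type_light i lL lC cP.
  by rewrite ltn_neqAle t0 eq_sym none.
by rewrite (sum_transversal_type lP cbP) sum_nat_const card_ord.
Qed.

(** * Action of row, column and symbol permutations on coloured TRPs *)

Lemma trp_transform (rA rB c s : 'S_10) (A B : square) :
  trp A B -> trp (transform rA c s A) (transform rB c s B).
Proof.
have lT r C : latin C -> latin (transform r c s C).
  case=> _ Cr Cc; split=> [i j|i k _|j k _]; first by rewrite inE.
    have [j [jE jU]] := Cr (r i) ((s^-1)%g k) (in_setT _).
    exists ((c^-1)%g j); split=> [|j']; first by rewrite !mxE permKV jE permKV.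
    by rewrite !mxE => E; rewrite (jU (c j')) ?permK // -E permK.
  have [i [iE iU]] := Cc (c j) ((s^-1)%g k) (in_setT _).
  exists ((r^-1)%g i); split=> [|i']; first by rewrite !mxE permKV iE permKV.
  by rewrite !mxE => E; rewrite (iU (r i')) ?permK // -E permK.
case=> lA lB AB; split; [exact: lT | exact: lT |] => i i' j j'.
rewrite !mxE => /perm_inj E /perm_inj E'.
by apply: (@perm_inj _ c); apply: AB E E'.
Qed.

Lemma symbols_ctransform (r c s : 'S_10) (A : csquare) :
  symbols (ctransform r c s A) = transform r c s (symbols A).
Proof. by apply/matrixP=> i j; rewrite !mxE. Qed.

Lemma symbols_colouring (L : square) : symbols (colouring L) = L.
Proof. by apply/matrixP=> i j; rewrite !mxE. Qed.

(** Darkness depends on the row index as well, so the rows of [L] must also respect the split at 6;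
    [column_perm] expresses this for [r] too. *)
Lemma colouring_transform (r c s : 'S_10) (L : square) :
  column_perm r -> column_perm c -> symbol_perm s ->
  colouring (transform r c s L) = ctransform r c s (colouring L).
Proof.
move=> r6 c6 s4; apply/matrixP=> i j.
by rewrite !mxE /cell_colour !mxE s4 r6 c6.
Qed.

Lemma coloured_by_transform (r rA c s : 'S_10) (L : square) (A : csquare) :
  column_perm r -> column_perm c -> symbol_perm s ->
  coloured_by L A -> coloured_by (transform r c s L) (ctransform rA c s A).
Proof.
move=> r6 c6 s4 LA i j; have [i' E] := LA (rA i) (c j).
exists ((r^-1)%g i'); rewrite colouring_transform //.
by rewrite mxE [RHS]mxE !mxE permKV -E mxE.
Qed.

Lemma coloured_trp_transform (r rA rB c s : 'S_10) (L : square)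
    (A B : csquare) :
  column_perm r -> column_perm c -> symbol_perm s -> coloured_trp L A B ->
  coloured_trp (transform r c s L) (ctransform rA c s A) (ctransform rB c s B).
Proof.
move=> r6 c6 s4 [AB cA cB]; split; last exact: coloured_by_transform.
  by rewrite !symbols_ctransform; apply: trp_transform.
exact: coloured_by_transform.
Qed.

Lemma transversal_type_ctransform (r c s : 'S_10) (A : csquare) i :
  column_perm c ->
  transversal_type (ctransform r c s A) i = transversal_type A (r i).
Proof.
move=> c6; rewrite -[RHS](card_preimset _ (@perm_inj _ c)).
by apply: eq_card => j; rewrite !inE !mxE leqNgt -c6 -leqNgt.
Qed.

Lemma column_perm_block (c : 'S_10) (p : 'I_4 -> 'I_4) :
  (forall x, c (@rshift 6 4 x) = @rshift 6 4 (p x)) -> column_perm c.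
Proof.
move=> cE j; pose high := [set j : 'I_10 | 6 <= j].
suff st : (c j \in high) = (j \in high).
  by move: st; rewrite !inE !(leqNgt 6) => /negb_inj.
apply: perm_stable => k; rewrite !inE => /high_rshift[x ->].
by rewrite cE /= leq_addr.
Qed.

(** * Bringing a row of type 1 and the corner to normal form simultaneously *)

Definition first_row_words : seq (seq nat) :=
  [:: [:: 0; 1; 2; 4; 5; 6; 3; 7; 8; 9];
      [:: 0; 1; 3; 4; 5; 6; 2; 7; 8; 9];
      [:: 0; 2; 3; 4; 5; 6; 1; 7; 8; 9]].

Lemma first_row_perm (b : 'I_4) : b != ord0 ->
  exists tau : 'S_10,
  [/\ [seq nat_of_ord (tau j) | j : 'I_10] \in first_row_words,
      tau ord0 = ord0, tau (@rshift 6 4 ord0) = @lshift 4 6 b &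
      forall j, (tau j \in white_symbols) = (nat_of_ord j \in [:: 0; 1; 2; 6])].
Proof.
move=> b0.
(* The three words have 3, 2, 1 in column 6, in this order, so index [3 - b] selects the one with
   [b] there. *)
pose w := nth [::] first_row_words (3 - b).
have [wP wU wS [w0 w6] w4] : [/\ w \in first_row_words,
  uniq w /\ all (gtn 10) w, size w = 10,
  nth 0 w 0 = 0 /\ nth 0 w 6 = b &
  all (fun j => (nth 0 w j < 4) == (j \in [:: 0; 1; 2; 6])) (iota 0 10)].
  by rewrite /w {w}; case: b b0 => [] [|[|[|[|//]]]].
move: wU => [wU /allP wlt].
have wL (j : 'I_10) : nth 0 w j < 10 by apply: wlt; rewrite mem_nth // wS.
have tI : injective (fun j : 'I_10 => Ordinal (wL j)).
  move=> j j' [] /eqP; rewrite nth_uniq ?wS // => /eqP; exact: val_inj.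
exists (perm tI); split.
- suff -> : [seq nat_of_ord (perm tI j) | j : 'I_10] = w by [].
  rewrite -[RHS](mkseq_nth 0) wS /mkseq -val_enum_ord -map_comp.
  by apply: eq_map => j; rewrite permE.
- by apply: val_inj; rewrite permE /= w0.
- by apply: val_inj; rewrite permE /= w6.
move=> j; rewrite permE mem_white.
by have := allP w4 j; rewrite mem_iota => /(_ (ltn_ord j))/eqP.
Qed.

Lemma row_word_lt_head (A : csquare) (i i' : 'I_10) :
  (row_word A i < row_word A i' :> seqlexi nat)%O ->
  (A i ord0).1 <= (A i' ord0).1.
Proof.
have consE k : row_word A k = nat_of_ord (A k ord0).1 :: behead (row_word A k).
  have : size (row_word A k) = 10 by rewrite size_map size_enum_ord.
  by rewrite -(row_word_nth A k ord0); case: (row_word A k).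
by rewrite consE [row_word A i']consE ltxi_cons => /andP[].
Qed.

(** The corner isotopy fixes [c] on the last four columns and the symbol permutation on white
    symbols. What remains free is which columns become 0, 1, 2, and these are chosen to receive the
    other three white symbols of row [i0] in the order of [tau]. *)
Lemma normalizing_perms (L : square) (P : csquare) (i0 : 'I_10) :
  latin L -> latin_on white_symbols (corner L) ->
  coloured_trp L P (colouring L) -> transversal_type P i0 = 1 ->
  exists c s rL : 'S_10,
  [/\ column_perm c, symbol_perm s, column_perm rL,
      corner (transform rL c s L) = Omega1 \/
      corner (transform rL c s L) = Omega2 &
      exists tau : 'S_10, [/\ forall j, s (P i0 (c j)).1 = tau j,
        [seq nat_of_ord (tau j) | j : 'I_10] \in first_row_words,
        tau ord0 = ord0 &
        forall j,
          (tau j \in white_symbols) = (nat_of_ord j \in [:: 0; 1; 2; 6])]].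
Proof.
move=> lL lC cP t1; have [[lP _ _] cbP _] := cP.
have piI : injective (fun j => (P i0 j).1).
  by move=> j j' E; apply: (latin_on_row_inj (i := i0) lP); rewrite !mxE.
pose pi := perm piI.
have piE j : pi j = (P i0 j).1 by rewrite permE.
have [j0 j0P] : exists j0, forall j : 'I_10,
    (6 <= j) && (pi j \in white_symbols) = (j == j0).
  move/eqP: t1 => /cards1P[j0 E]; exists j0 => j.
  by rewrite -in_set1 -E !inE (coloured_by_white _ _ cbP) piE inE.
have /andP[/high_rshift[x0 j0E] /white_lshift[a aE]] :
  (6 <= j0) && (pi j0 \in white_symbols) by rewrite j0P.
pose f x y : 'I_4 := inord (corner L x y).
have fE x y : corner L x y = @lshift 4 6 (f x y).
  have [+ _ _] := lC; move=> /(_ x y); rewrite inE => lt.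
  by apply: val_inj; rewrite /= inordK.
have fr x : injective (f x).
  by move=> y y' E; apply: (latin_on_row_inj (i := x) lC); rewrite !fE E.
have fc y : injective (f^~ y).
  by move=> x x' E; apply: (latin_on_col_inj (j := y) lC); rewrite !fE E.
have [r [p [s4 [p0 s4a [rows rowsP sf]]]]] := latin4_isotopy x0 a fr fc.
have [tau [tauW tau0 tau6 tauP]] := first_row_perm s4a.
have [sigma sigmaE] : exists q : 'S_10, forall x : 'I_4,
    q (@lshift 4 6 x) = @lshift 4 6 (s4 x).
  apply: (@perm_extend _ _ (@lshift 4 6) (fun x => @lshift 4 6 (s4 x))).
    exact: lshift_inj.
  by move=> x y /lshift_inj/perm_inj.
have [rL rLE] : exists q : 'S_10, forall x : 'I_4,
    q (@rshift 6 4 x) = @rshift 6 4 (r x).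
  apply: (@perm_extend _ _ (@rshift 6 4) (fun x => @rshift 6 4 (r x))).
    exact: rshift_inj.
  by move=> x y /rshift_inj/perm_inj.
have sigmaW : symbol_perm sigma.
  apply: perm_stable => _ /white_lshift[x ->].
  by rewrite sigmaE inE /=.
(* [h] lists the columns where [c] is prescribed and [k] their images; for 0, 1, 2 the image is
   where row [i0] has the symbol that [sigma] sends to the required one. *)
pose h (u : 'I_3 + 'I_4) : 'I_10 :=
  match u with inl j => @lshift 3 7 j | inr x => @rshift 6 4 x end.
pose k (u : 'I_3 + 'I_4) : 'I_10 :=
  match u with
  | inl j => (pi^-1)%g ((sigma^-1)%g (tau (@lshift 3 7 j)))
  | inr x => @rshift 6 4 (p x)
  end.
have h_lr j x : h (inl j) <> h (inr x).
  move/(congr1 val) => /= E; have := ltn_ord j; by rewrite E.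
(* A collision would put a white cell of row [i0] in the last four columns, so in [j0]; but its
   symbol is already used by [tau] in column 6. *)
have k_lr j x : k (inl j) <> k (inr x).
  move=> E; set y := k (inr x) in E.
  have tauE : tau (@lshift 3 7 j) = sigma (pi y) by rewrite -E !permKV.
  have y6 : 6 <= y by exact: leq_addr.
  have /eqP yE : y == j0.
    rewrite -j0P y6 -sigmaW -tauE tauP /= !inE.
    by case: (j) => [] [|[|[|]]].
  move: tauE; rewrite yE aE sigmaE -tau6 => /perm_inj/(congr1 val) /= E'.
  by have := ltn_ord j; rewrite E'.
have [c cE] : exists c : 'S_10, forall u, c (h u) = k u.
  apply: (@perm_extend _ _ h k) => -[j|x] [j'|x'].
  - by move/(@lshift_inj 3 7) ->.
  - by move/h_lr.
  - by move/esym/h_lr.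
  - by move/(@rshift_inj 6 4) ->.
  - by move/perm_inj/perm_inj/perm_inj/(@lshift_inj 3 7) ->.
  - by move/k_lr.
  - by move/esym/k_lr.
  - by move/(@rshift_inj 6 4)/perm_inj ->.
have cR x : c (@rshift 6 4 x) = @rshift 6 4 (p x) := cE (inr x).
(* White positions of the word are 0, 1, 2, handled by the choice of [k], and 6, handled by
   [p ord0 = x0]. *)
have sigma_c j : tau j \in white_symbols -> sigma (pi (c j)) = tau j.
  rewrite tauP !inE => jP; case: (ltnP j 3) => [lj|j3].
    have -> : j = h (inl (Ordinal lj)) by apply: val_inj.
    by rewrite cE !permKV.
  have -> : j = @rshift 6 4 ord0.
    apply: val_inj => /=; move: jP j3.
    by case: (nat_of_ord j) => [|[|[|[|[|[|[|]]]]]]].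
  by rewrite cR p0 -j0E aE sigmaE tau6.
(* The symbol permutation is forced by the row i0, and agrees with the one
   of the corner isotopy on the white symbols. *)
pose s := (pi^-1 * c^-1 * tau)%g.
have sE j : s (pi (c j)) = tau j by rewrite !permM !permK.
have s_sigma x : x \in white_symbols -> s x = sigma x.
  move=> xW; pose j := (tau^-1)%g (sigma x).
  have jE : tau j = sigma x by rewrite permKV.
  have : sigma (pi (c j)) = tau j by apply: sigma_c; rewrite jE sigmaW.
  by rewrite jE => /perm_inj <-; rewrite sE jE sigma_c ?jE ?sigmaW //.
exists c, s, rL; split.
- exact: column_perm_block cR.
- by apply: perm_stable => x xW; rewrite s_sigma ?sigmaW.
- exact: column_perm_block rLE.
- have cornerE x y : corner (transform rL c s L) x y =
      nth 0 (nth [::] rows x) y :> nat.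
    rewrite !mxE rLE cR -sf.
    have := fE (r x) (p y); rewrite !mxE => ->.
    by rewrite s_sigma ?sigmaE ?inE //=.
  have lt4 x y : corner (transform rL c s L) x y < 4.
    by rewrite cornerE -sf.
  have cornerI : corner (transform rL c s L) = square4 rows.
    apply/matrixP => x y; rewrite [RHS]mxE; apply: val_inj.
    by rewrite /= inordK -cornerE.
  move: rowsP; rewrite cornerI !inE => /orP[] /eqP ->; [by left|by right].
by exists tau; split=> // j; rewrite -piE sE.
Qed.

Theorem theorem2 (L : square) (P Q : csquare) :
  latin L ->
  latin_on white_symbols (corner L) ->
  latin (symbols P) ->
  latin (symbols Q) ->
  coloured_trp L P Q ->
  coloured_trp L P (colouring L) ->
  coloured_trp L Q (colouring L) ->
  exists (c s rL : 'S_10) (P' Q' : csquare),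
    let L' := transform rL c s L in
    [/\ equivalent_via c s P Q P' Q',
        normal_form L' P' Q',
        latin L',
        corner L' = Omega1 \/ corner L' = Omega2
      & coloured_trp L' P' (colouring L') /\
        coloured_trp L' Q' (colouring L')].
Proof.
move=> lL lC lP lQ PQ PL QL.
have [i0 t1] := exists_transversal_type1 lL lC PL.
have [c [s [rL [c6 s4 rL6 cornerE [tau [tauE tauW tau0 tauP]]]]]] :=
  normalizing_perms lL lC PL t1.
have PL' rP : coloured_trp (transform rL c s L) (ctransform rP c s P)
    (colouring (transform rL c s L)).
  by rewrite colouring_transform //; apply: coloured_trp_transform.
have QL' rQ : coloured_trp (transform rL c s L) (ctransform rQ c s Q)
    (colouring (transform rL c s L)).
  by rewrite colouring_transform //; apply: coloured_trp_transform.
(* Sorting comes after the column and symbol permutations, since these change the words; the sorting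
   permutation is then absorbed as the row permutation. *)
have sorted A : (forall r, latin (symbols (ctransform r c s A))) ->
    exists r, sorted_rows (ctransform r c s A).
  move=> lA; have [r] := exists_sorted_rows (lA 1%g); exists r.
  suff -> : ctransform r c s A = row_perm r (ctransform 1 c s A) by [].
  by apply/matrixP=> i j; rewrite !mxE perm1.
have [|rP sP] := sorted P; first by move=> r; have [[]] := PL' r.
have [|rQ sQ] := sorted Q; first by move=> r; have [[]] := QL' r.
set P' := ctransform rP c s P in sP.
have P'E i j : P' i j = (s (P (rP i) (c j)).1, (P (rP i) (c j)).2).
  by rewrite !mxE.
(* If row [i0] landed at [i1 > 0], row 0 would also have the minimal type 1 and a smaller word, so
   it would also start with 0, and column 0 being Latin identifies the two rows. *)
have rP0 : rP ord0 = i0.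
  pose i1 := (rP^-1)%g i0; have i1E : rP i1 = i0 by rewrite permKV.
  have P'0 : (P' i1 ord0).1 = ord0 by rewrite P'E i1E /= tauE.
  have [[lP' _ _] _ _] := PL' rP.
  case: (posnP i1) => [i10|i1_gt0].
    by rewrite -i1E; congr (rP _); apply: val_inj.
  have tE : transversal_type P' ord0 = transversal_type P' i1.
    apply/eqP; rewrite eqn_leq sP.1 //= !transversal_type_ctransform // i1E t1.
    by have [] := transversal_type_light (rP ord0) lL lC PL.
  have /row_word_lt_head := sP.2 ord0 i1 i1_gt0 tE; rewrite P'0 leqn0 => /eqP E.
  rewrite -i1E; congr (rP _); apply: (latin_on_col_inj (j := ord0) lP').
  have symE i : symbols P' i ord0 = (P' i ord0).1 by rewrite mxE.
  by apply: val_inj; rewrite /= !symE E P'0.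
exists c, s, rL, P', (ctransform rQ c s Q); split=> //.
- by split=> //; exists rP, rQ.
- split=> //; first exact: coloured_trp_transform.
  split=> [|j].
    suff -> : row_word P' ord0 = [seq nat_of_ord (tau j) | j : 'I_10] by [].
    by apply: eq_map => j; rewrite P'E rP0 /= tauE.
  (* Row [i0] has type 1, so its colours are determined by which symbols are white; [s] preserves
     whiteness. *)
  have [_ light] := transversal_type_light i0 lL lC PL.
  by rewrite P'E rP0 /= light // -s4 tauE tauP.
- by have [[_ + _] _ _] := PL' rP; rewrite symbols_colouring.
by split; [exact: PL' | exact: QL'].
Qed.
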